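(* Let $\delta>0$, $\mu>0$ and $g=(g_n)_{n\in\mathbb{Z}}\in l^2$ satisfy $$\delta^2<3\sum_{n\in\mathbb{Z}}|g_n|^{4/3},$$ and let $R_\mu>0$ satisfy $R_\mu^2<\frac{\delta}{4\mu}$, the initial data $\psi_0$ being such that $0<\|\psi_0\|_{l^2}^2\le R_\mu^2$. Let $\rho\ge 0$ be given by $$\rho^2=\frac{4}{\delta}\,\frac{\|g\|_{l^2}^2}{\delta-4\mu R_\mu^2},$$ and let $r$ satisfy $\rho<r<R_\mu$. Then the semigroup $\{S_\mu(t)\}_{t\ge0}$ associated with the dfAL possesses a unique restricted global attractor $\mathcal{A}_\mu\subset B_r\subset l^2$.
   Context: $l^2$ is the Hilbert space of complex sequences $\varphi=(\varphi_n)_{n\in\mathbb{Z}}$ with $\|\varphi\|_{l^2}=(\sum_n|\varphi_n|^2)^{1/2}<\infty$, and $B_R=\{\varphi\in l^2:\|\varphi\|_{l^2}<R\}$. The damped and forced Ablowitz-Ladik equation (dfAL) is $$i\frac{d\psi_n}{dt}=(\psi_{n+1}-2\psi_n+\psi_{n-1})+\mu|\psi_n|^2(\psi_{n+1}+\psi_{n-1})-i\delta\psi_n+g_n,\quad n\in\mathbb{Z},$$ with $\psi_n(0)=\psi_{n,0}$. For every $\psi_0\in l^2$ it has a unique solution $\psi\in C^1([0,\infty),l^2)$, and $S_\mu(t):\psi_0\mapsto\psi(t)$, $t\ge0$, is the associated continuous semigroup on $l^2$. Restricted global attractor: $\mathcal{A}_\mu\subset l^2$ is a restricted global attractor for $\{S_\mu(t)\}_{t\ge0}$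 in $l^2$ if for some closed, nonempty subset $U\subset B_{R_\mu}$ of $l^2$, $S_\mu(t):U\to U$ ($t\ge0$) is a semigroup on $U$ such that $\mathcal{A}_\mu$ is a global attractor for $\{S_\mu(t)\}_{t\ge0}$ restricted to $U$, that is, (i) $S_\mu(t)\mathcal{A}_\mu=\mathcal{A}_\mu$ for $t\ge0$, (ii) $\mathcal{A}_\mu$ is compact (and nonempty), and (iii) $\mathcal{A}_\mu$ attracts solutions of bounded subsets of $U$: for every bounded $B\subset U$, $\lim_{t\to\infty}\mathrm{dist}(S_\mu(t)B,\mathcal{A}_\mu)=0$, where $\mathrm{dist}(V,W)=\sup_{v\in V}\inf_{w\in W}\|v-w\|_{l^2}$. *)

(* Defs.v *)
From HB Require Import structures.
From mathcomp Require Import all_boot all_order all_algebra.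
From mathcomp Require Import complex.
From mathcomp Require Import all_classical all_reals all_analysis.
From mathcomp Require Import ring.
Import Order.TTheory GRing.Theory Num.Theory.
Import numFieldNormedType.Exports.

Set Implicit Arguments.
Unset Strict Implicit.
Unset Printing Implicit Defensive.

Local Open Scope classical_set_scope.
Local Open Scope ring_scope.

(* [Rcomplex R] is [R[i]] with its structure of normed space over [R]: the
   modulus of [z : Rcomplex R] lies in [R], that of [z : R[i]] lies in [R[i]]. *)

Section l2_space.
Context {R : realType}.

(* Unconditional sum over the integers, with values in [0, +oo]. *)
Definition sqr_sum (f : int -> Rcomplex R) : \bar R :=
  \esum_(n in [set: int]) (`|f n| ^+ 2)%:E.

Definition sqr_summable : {pred (int -> Rcomplex R)} :=
  [pred f | (sqr_sum f < +oo)%E].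

Record l2 : Type := L2 {
  l2_seq :> int -> Rcomplex R ;
  _ : l2_seq \in sqr_summable }.

HB.instance Definition _ := [isSub for l2_seq].
HB.instance Definition _ := [Choice of l2 by <:].

Lemma le_esumZ (c : R) (u : int -> R) : 0 <= c -> (forall n, 0 <= u n) ->
  (\esum_(n in [set: int]) (c * u n)%:E <=
     c%:E * \esum_(n in [set: int]) (u n)%:E)%E.
Proof.
move=> c0 u0; apply: ge_ereal_sup => _ [A [finA _] <-].
rewrite (eq_fsbigr (fun n => c%:E * (u n)%:E)%E); last first.
  by move=> n _; rewrite EFinM.
rewrite -ge0_mule_fsumr; last by move=> n; rewrite lee_fin.
by apply: lee_wpmul2l; [rewrite lee_fin|apply: ereal_sup_ubound; exists A].
Qed.

Lemma sqr_sum_ge0 f : (0 <= sqr_sum f)%E.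
Proof. by apply: esum_ge0 => n _; rewrite lee_fin sqr_ge0. Qed.

Lemma sqr_sum0 : sqr_sum 0 = 0%E.
Proof. by apply: esum1 => n _; rewrite normr0 expr0n. Qed.

Lemma RcomplexZ_norm (a : R) (z : Rcomplex R) : `|a *: z| = `|a| * `|z|.
Proof.
case: z => x y.
have /(congr1 Num.sqrt) : (a * x) ^+ 2 + (a * y) ^+ 2 = a ^+ 2 * (x ^+ 2 + y ^+ 2).
  by ring.
by rewrite sqrtrM ?sqr_ge0// sqrtr_sqr.
Qed.

Lemma le_sqr_sumZ (a : R) f : (sqr_sum (a *: f)%R <= (a ^+ 2)%:E * sqr_sum f)%E.
Proof.
rewrite /sqr_sum; under eq_esum do
  rewrite /= RcomplexZ_norm exprMn real_normK ?num_real//.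
by apply: le_esumZ => [|n]; rewrite sqr_ge0.
Qed.

Lemma le_sqr_sumD (s : R) f g : 0 < s ->
  (sqr_sum (f + g)%R <= (1 + s)%:E * sqr_sum f + (1 + s^-1)%:E * sqr_sum g)%E.
Proof.
move=> s0; have s10 : 0 <= 1 + s by rewrite addr_ge0// ltW.
have s20 : 0 <= 1 + s^-1 by rewrite addr_ge0// invr_ge0 ltW.
have sq0 (h : int -> Rcomplex R) n : 0 <= `|h n| ^+ 2 by rewrite sqr_ge0.
apply: (le_trans _ (leeD (le_esumZ s10 (sq0 f)) (le_esumZ s20 (sq0 g)))).
rewrite -esumD; try by move=> n _; rewrite lee_fin mulr_ge0.
apply: le_esum => n _; rewrite -EFinD lee_fin.
have le1 : `|(f + g) n| ^+ 2 <= (`|f n| + `|g n|) ^+ 2.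
  by rewrite ler_pXn2r// ?nnegrE ?addr_ge0// ler_normD.
apply: (le_trans le1); rewrite -subr_ge0.
rewrite [leRHS](_ : _ = (s * `|f n| - `|g n|) ^+ 2 / s).
  by rewrite divr_ge0 ?sqr_ge0// ltW.
by field; rewrite gt_eqF.
Qed.

Lemma sqr_summable_submod : submod_closed sqr_summable.
Proof.
split=> [|a f g]; rewrite !inE ?sqr_sum0//= => fi gi.
apply: (le_lt_trans (le_sqr_sumD _ _ ltr01)).
rewrite lte_add_pinfty// lte_mul_pinfty ?sqr_sum_ge0 ?lee_fin ?addr_ge0 ?invr_ge0//.
apply: (le_lt_trans (le_sqr_sumZ _ _)).
by rewrite lte_mul_pinfty ?sqr_sum_ge0 ?lee_fin ?sqr_ge0.
Qed.

HB.instance Definition _ := GRing.isSubmodClosed.Build R (int -> Rcomplex R)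
  sqr_summable sqr_summable_submod.
HB.instance Definition _ := [SubChoice_isSubLmodule of l2 by <:].

Lemma sqr_sum_fin (f : l2) : sqr_sum f \is a fin_num.
Proof.
by rewrite ge0_fin_numE ?sqr_sum_ge0//; case: f => f /=; rewrite inE.
Qed.

Definition l2_norm (f : l2) : R := Num.sqrt (fine (sqr_sum f)).

Lemma sqr_l2_norm f : ((l2_norm f ^+ 2)%:E = sqr_sum f)%E.
Proof.
by rewrite sqr_sqrtr ?fine_ge0 ?sqr_sum_ge0// fineK// sqr_sum_fin.
Qed.

Lemma l2_norm_ge0 f : 0 <= l2_norm f. Proof. exact: sqrtr_ge0. Qed.

Lemma l2_norm_eq0 f : l2_norm f = 0 -> f = 0.
Proof.
move=> f0; apply/val_inj/funext => n; apply/eqP; rewrite -normr_eq0.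
rewrite -sqrf_eq0 eq_le sqr_ge0 andbT -lee_fin.
have <- : sqr_sum f = 0%R%:E by rewrite -sqr_l2_norm f0 expr0n.
rewrite -(@esum_set1 _ _ n (fun n => (`|f n| ^+ 2)%:E)) ?lee_fin ?sqr_ge0//.
rewrite /sqr_sum (esum_mkcond [set n]); apply: le_esum => m _.
by case: ifP => // _; rewrite lee_fin sqr_ge0.
Qed.

Lemma le_l2_normZ (a : R) f : l2_norm (a *: f) <= `|a| * l2_norm f.
Proof.
rewrite -(@ler_pXn2r _ 2%N)// ?nnegrE ?mulr_ge0 ?l2_norm_ge0//.
rewrite exprMn real_normK ?num_real// -lee_fin [leRHS]EFinM !sqr_l2_norm.
exact: le_sqr_sumZ.
Qed.

Lemma l2_normZ (a : R) f : l2_norm (a *: f) = `|a| * l2_norm f.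
Proof.
apply/eqP; rewrite eq_le le_l2_normZ/=.
have [->|a0] := eqVneq a 0; first by rewrite normr0 mul0r l2_norm_ge0.
rewrite -ler_pdivlMl ?normr_gt0// -normfV.
by apply: le_trans (le_l2_normZ _ _); rewrite scalerA mulVf// scale1r.
Qed.

Lemma l2_normD (f g : l2) : l2_norm (f + g) <= l2_norm f + l2_norm g.
Proof.
have [/eqP f0|f0] := eqVneq (l2_norm f) 0.
  by rewrite (eqP f0) add0r (l2_norm_eq0 (eqP f0)) add0r.
have [/eqP g0|g0] := eqVneq (l2_norm g) 0.
  by rewrite (eqP g0) addr0 (l2_norm_eq0 (eqP g0)) addr0.
have fp : 0 < l2_norm f by rewrite lt_def f0 l2_norm_ge0.
have gp : 0 < l2_norm g by rewrite lt_def g0 l2_norm_ge0.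
rewrite -(@ler_pXn2r _ 2%N)// ?nnegrE ?addr_ge0 ?l2_norm_ge0//.
have /(le_sqr_sumD f g) : 0 < l2_norm g / l2_norm f by rewrite divr_gt0.
rewrite -[X in sqr_sum X]/(l2_seq (f + g)).
rewrite -!sqr_l2_norm -!EFinM -EFinD lee_fin => /le_trans; apply.
by rewrite le_eqVlt; apply/orP; left; apply/eqP; field; rewrite f0 g0.
Qed.

HB.instance Definition _ := Lmodule_isNormed.Build R l2
  l2_normD l2_normZ l2_norm_eq0.

End l2_space.
Arguments l2 R : clear implicits.

Section flow.
Context {R : realType}.
Implicit Types (psi dpsi : R -> l2 R) (A B U V W : set (l2 R)) (S : R -> l2 R -> l2 R).

(* [psi] is C^1 from [0, +oo[ to l2 with derivative [dpsi]. Only increments that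
   stay in [0, +oo[ are considered, so the derivative at 0 is one-sided and the
   values of [psi] at negative times are irrelevant. *)
Definition C1_half_line psi dpsi : Prop :=
  {within `[(0 : R), +oo[, continuous dpsi} /\
  forall t : R, 0 <= t ->
    h^-1 *: (psi (t + h) - psi t) @[h --> within [set h | 0 <= t + h] 0^']
      --> dpsi t.

(* The equation at one time; [phi'] stands for the time derivative of [phi]. *)
Definition dfAL_eq (delta mu : R) (g phi phi' : l2 R) : Prop :=
  let z : int -> R[i] := phi in
  let z' : int -> R[i] := phi' in
  let f : int -> R[i] := g in
  forall n : int,
    'i * z' n = (z (n + 1) - 2 * z n + z (n - 1))
                + (mu%:C)%C * `|z n| ^+ 2 * (z (n + 1) + z (n - 1))
                - 'i * (delta%:C)%C * z n + f n.

Definition dfAL_solution (delta mu : R) (g psi0 : l2 R) psi : Prop :=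
  psi 0 = psi0 /\
  exists2 dpsi, C1_half_line psi dpsi &
    forall t : R, 0 <= t -> dfAL_eq delta mu g (psi t) (dpsi t).

(* [S t psi0] is the value at time [t >= 0] of the (unique) solution starting
   at [psi0]; it is unconstrained for [t < 0]. *)
Definition dfAL_semigroup (delta mu : R) (g : l2 R) S : Prop :=
  forall psi0 : l2 R, dfAL_solution delta mu g psi0 (fun t => S t psi0).

Definition semigroup_on S U : Prop :=
  [/\ forall t : R, 0 <= t -> S t @` U `<=` U,
      forall u, U u -> S 0 u = u &
      forall (s t : R) u, 0 <= s -> 0 <= t -> U u -> S (s + t) u = S s (S t u)].

(* The supremum is taken in [0, +oo], so that it is 0 for an empty [V]. *)
Definition dist V W : \bar R :=
  maxe 0%E (ereal_sup [set ereal_inf [set (`|v - w|)%:E | w in W] | v in V]).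

Definition global_attractor_on S U A : Prop :=
  [/\ A `<=` U,
      forall t : R, 0 <= t -> S t @` A = A,
      compact A,
      A !=set0 &
      forall B, B `<=` U -> bounded_set B ->
        dist (S t @` B) A @[t --> +oo] --> 0%E].

Definition restricted_global_attractor S (Rmu : R) A : Prop :=
  exists U, [/\ closed U, U !=set0, U `<=` ball (0 : l2 R) Rmu,
                semigroup_on S U & global_attractor_on S U A].

End flow.

(* Main.v *)
Require Import Defs.
From HB Require Import structures.
From mathcomp Require Import all_boot all_order all_algebra.
From mathcomp Require Import finmap complex.
From mathcomp Require Import all_classical all_reals all_analysis.
From mathcomp Require Import ring lra.
Import Order.TTheory GRing.Theory Num.Theory.
Import numFieldNormedType.Exports.

Set Implicit Arguments.
Unset Strict Implicit.
Unset Printing Implicit Defensive.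

Local Open Scope classical_set_scope.
Local Open Scope ring_scope.

(** Write [k = delta - 2 mu Rmu^2]. As long as a solution stays in the ball of
    radius [Rmu], the conservative part of the equation does not contribute to
    the derivative of [|psi|^2] and the cubic part contributes at most
    [4 mu |psi|^4], so that [|psi|^2 - (|g|/k)^2] decays exponentially; hence
    every invariant set contained in this ball lies in the ball of radius
    [|g|/k]. The definition of [rho] gives [|g|/k <= rho/2 < Rmu/2]. The closed
    ball of radius [Rmu/2] is therefore forward invariant, and on it the cubic
    term is Lipschitz with constant [6 mu (Rmu/2)^2 < delta], so that the
    difference of two solutions decays exponentially: the flow is contracting.
    Its fixed point attracts the whole ball, and it is the only point of any
    restricted global attractor. *)

(** * Sums of squares and the real inner product of l2 *)

Section l2_sums.
Context {R : realType}.
Implicit Types (f g h : l2 R) (z : Rcomplex R).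

Lemma sqr_norm_Rcomplex z : `|z| ^+ 2 = complex.Re z ^+ 2 + complex.Im z ^+ 2.
Proof. by case: z => x y; rewrite sqr_sqrtr// addr_ge0// sqr_ge0. Qed.

(** Bundled as a tuple so that one [rewrite] turns a pointwise complex identity into a real one
    within reach of [ring]. *)
Lemma Re_Rcomplex_combE :
  (forall z w : Rcomplex R, complex.Re (z + w) = complex.Re z + complex.Re w) *
  (forall z : Rcomplex R, complex.Re (- z) = - complex.Re z) *
  (forall (a : R) (z : Rcomplex R), complex.Re (a *: z) = a * complex.Re z).
Proof. by split=> [|a [? ?]//]; split=> [[? ?] [? ?]|[? ?]]. Qed.

Lemma Im_Rcomplex_combE :
  (forall z w : Rcomplex R, complex.Im (z + w) = complex.Im z + complex.Im w) *
  (forall z : Rcomplex R, complex.Im (- z) = - complex.Im z) *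
  (forall (a : R) (z : Rcomplex R), complex.Im (a *: z) = a * complex.Im z).
Proof. by split=> [|a [? ?]//]; split=> [[? ?] [? ?]|[? ?]]. Qed.

Definition Rcomplex_combE := (Re_Rcomplex_combE, Im_Rcomplex_combE).

Lemma seq_combE (n : int) :
  (forall u v : int -> Rcomplex R, (u + v) n = u n + v n) *
  (forall u : int -> Rcomplex R, (- u) n = - u n) *
  (forall (a : R) (u : int -> Rcomplex R), (a *: u) n = a *: u n).
Proof. by []. Qed.

Lemma Re_le_norm z : `|complex.Re z| <= `|z|.
Proof.
rewrite -(@ler_pXn2r _ 2)// ?nnegrE// real_normK ?num_real//.
by rewrite sqr_norm_Rcomplex lerDl sqr_ge0.
Qed.

Lemma Im_le_norm z : `|complex.Im z| <= `|z|.
Proof.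
rewrite -(@ler_pXn2r _ 2)// ?nnegrE// real_normK ?num_real//.
by rewrite sqr_norm_Rcomplex lerDr sqr_ge0.
Qed.

(** The missing inequality is [le_esumZ] applied with the factor [c^-1] to the terms [c * u n]. *)
Lemma esumZ (c : R) (u : int -> R) : 0 <= c -> (forall n, 0 <= u n) ->
  (\esum_(n in [set: int]) (c * u n)%:E =
   c%:E * \esum_(n in [set: int]) (u n)%:E)%E.
Proof.
move=> c0 u0; apply/le_anti; rewrite le_esumZ//=.
have [->|cn0] := eqVneq c 0.
  by rewrite mul0e; apply: esum_ge0 => n _; rewrite mul0r.
have cp : 0 < c by rewrite lt_def cn0.
rewrite -lee_pdivlMl//.
rewrite [in leLHS](eq_esum (b := fun n => (c^-1 * (c * u n))%:E)); last first.
  by move=> n _; rewrite mulKf.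
apply: le_esumZ => [|n]; first by rewrite invr_ge0.
exact: mulr_ge0.
Qed.

Lemma sqr_norm_l2 f : ((`|f| ^+ 2)%:E = sqr_sum f)%E.
Proof. exact: sqr_l2_norm. Qed.

(* Transfers pointwise identities with nonnegative coefficients to the squared
   norms, so that no conditionally convergent sum has to be handled. *)
Lemma sum_sqr_norm (s : seq (R * l2 R)) : all (fun p => 0 <= p.1) s ->
  ((\sum_(p <- s) p.1 * `|p.2| ^+ 2)%:E =
   \esum_(n in [set: int]) (\sum_(p <- s) p.1 * `|p.2 n| ^+ 2)%:E)%E.
Proof.
elim: s => [|[a f] s IH] /=.
  by rewrite big_nil esum1// => n _; rewrite big_nil.
move=> /andP[a0 s0]; rewrite big_cons EFinD IH//= EFinM sqr_norm_l2.
rewrite /sqr_sum -esumZ//.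
rewrite -esumD; last 2 first.
- by move=> n _; rewrite lee_fin mulr_ge0 ?sqr_ge0.
- move=> n _; rewrite lee_fin big_seq sumr_ge0// => p ps.
  by rewrite mulr_ge0 ?sqr_ge0//; exact: (allP s0).
by apply: eq_esum => n _; rewrite big_cons EFinD.
Qed.

Lemma eq_sum_sqr_norm (s1 s2 : seq (R * l2 R)) :
  all (fun p => 0 <= p.1) s1 -> all (fun p => 0 <= p.1) s2 ->
  (forall n, \sum_(p <- s1) p.1 * `|p.2 n| ^+ 2 =
             \sum_(p <- s2) p.1 * `|p.2 n| ^+ 2) ->
  \sum_(p <- s1) p.1 * `|p.2| ^+ 2 = \sum_(p <- s2) p.1 * `|p.2| ^+ 2.
Proof.
move=> s10 s20 s12; apply: EFin_inj; rewrite !sum_sqr_norm//.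
by apply: eq_esum => n _; rewrite s12.
Qed.

Lemma le_sqr_sum (c : R) (u v : int -> Rcomplex R) : 0 <= c ->
  (forall n, `|u n| <= c * `|v n|) -> (sqr_sum u <= (c ^+ 2)%:E * sqr_sum v)%E.
Proof.
move=> c0 uv; rewrite /sqr_sum -esumZ ?sqr_ge0//.
apply: le_esum => n _; rewrite lee_fin -exprMn.
by rewrite ler_pXn2r// nnegrE// mulr_ge0.
Qed.

Lemma l2_dominated (c : R) (u : int -> Rcomplex R) f : 0 <= c ->
  (forall n, `|u n| <= c * `|f n|) -> u \in sqr_summable.
Proof.
move=> c0 uf; rewrite inE; apply: (le_lt_trans (le_sqr_sum c0 uf)).
by rewrite -sqr_norm_l2 -EFinM ltry.
Qed.

Lemma le_norm_l2 (c : R) f g : 0 <= c ->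
  (forall n, `|f n| <= c * `|g n|) -> `|f| <= c * `|g|.
Proof.
move=> c0 fg; rewrite -(@ler_pXn2r _ 2)// ?nnegrE ?mulr_ge0//.
by rewrite exprMn -lee_fin [leRHS]EFinM !sqr_norm_l2 le_sqr_sum.
Qed.

Lemma le_coord_norm f n : `|f n| <= `|f|.
Proof.
rewrite -(@ler_pXn2r _ 2)// ?nnegrE// -lee_fin sqr_norm_l2.
rewrite -(@esum_set1 _ _ n (fun n => (`|f n| ^+ 2)%:E)) ?lee_fin ?sqr_ge0//.
rewrite /sqr_sum (esum_mkcond [set n]); apply: le_esum => m _.
by case: ifP => // _; rewrite lee_fin sqr_ge0.
Qed.

End l2_sums.

Section l2_inner_product.
Context {R : realType}.
Implicit Types (f g h : l2 R).

(* The real part of the inner product, defined by polarization. *)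
Definition l2_dot f g : R := (`|f + g| ^+ 2 - `|f| ^+ 2 - `|g| ^+ 2) / 2.

Lemma l2_dotC f g : l2_dot f g = l2_dot g f.
Proof. by rewrite /l2_dot (addrC f g) addrAC. Qed.

Lemma l2_dotDr f g h : l2_dot f (g + h) = l2_dot f g + l2_dot f h.
Proof.
(* Additivity of the polarized form is equivalent to an identity between seven squared norms, all
   with coefficient 1, which can therefore be checked coordinatewise. *)
have key (a b c d : l2 R) :
    (forall n, `|a n| ^+ 2 + `|f n| ^+ 2 + `|g n| ^+ 2 + `|h n| ^+ 2 =
      `|b n| ^+ 2 + `|c n| ^+ 2 + `|d n| ^+ 2) ->
    `|a| ^+ 2 + `|f| ^+ 2 + `|g| ^+ 2 + `|h| ^+ 2 =
      `|b| ^+ 2 + `|c| ^+ 2 + `|d| ^+ 2.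
  move=> abcd; have := @eq_sum_sqr_norm _ [:: (1, a); (1, f); (1, g); (1, h)]
    [:: (1, b); (1, c); (1, d)].
  rewrite /= !(big_cons, big_nil) /= !mul1r !addr0 !ler01 !addrA; apply => // n.
  by rewrite !(big_cons, big_nil) /= !mul1r !addr0 !addrA.
have := key (f + (g + h)) (f + g) (f + h) (g + h).
rewrite /l2_dot; move: `|f + (g + h)| `|f + g| `|f + h| `|g + h| => a b c d.
move: `|f| `|g| `|h| => x y z e; suff: a ^+ 2 + x ^+ 2 + y ^+ 2 + z ^+ 2 =
  b ^+ 2 + c ^+ 2 + d ^+ 2 by lra.
apply: e => n; rewrite !sqr_norm_Rcomplex.
by rewrite /= !seq_combE !Rcomplex_combE; ring.
Qed.

(** The scalar becomes a weight in sums with values in [0, +oo], hence its sign condition;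
    [l2_dotZr] removes it through [l2_dotNr]. *)
Lemma l2_dotZr_ge0 (a : R) f g : 0 <= a -> l2_dot f (a *: g) = a * l2_dot f g.
Proof.
move=> a0.
suff: `|f + a *: g| ^+ 2 + a * `|f| ^+ 2 + a * `|g| ^+ 2 =
    a * `|f + g| ^+ 2 + `|f| ^+ 2 + `|a *: g| ^+ 2.
  rewrite /l2_dot; move: `|f + a *: g| `|f + g| `|a *: g| `|f| `|g| => *; lra.
have := @eq_sum_sqr_norm _ [:: (1, f + a *: g); (a, f); (a, g)]
  [:: (a, f + g); (1, f); (1, a *: g)].
rewrite /= !(big_cons, big_nil) /= !mul1r !addr0 !ler01 !addrA a0; apply => // n.
rewrite !(big_cons, big_nil) /= !mul1r !addr0 !sqr_norm_Rcomplex.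
by rewrite !seq_combE !Rcomplex_combE; ring.
Qed.

Lemma l2_dot0r f : l2_dot f 0 = 0.
Proof. by rewrite -(scale0r f) l2_dotZr_ge0 ?mul0r. Qed.

Lemma l2_dotNr f g : l2_dot f (- g) = - l2_dot f g.
Proof.
by apply/eqP; rewrite -addr_eq0 -l2_dotDr addNr l2_dot0r.
Qed.

Lemma l2_dotZr (a : R) f g : l2_dot f (a *: g) = a * l2_dot f g.
Proof.
have [/l2_dotZr_ge0//|a0] := leP 0 a.
by rewrite -[a]opprK scaleNr l2_dotNr l2_dotZr_ge0 ?mulNr// oppr_ge0 ltW.
Qed.

Lemma l2_dotBr f g h : l2_dot f (g - h) = l2_dot f g - l2_dot f h.
Proof. by rewrite l2_dotDr l2_dotNr. Qed.

Lemma l2_dotff f : l2_dot f f = `|f| ^+ 2.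
Proof.
by rewrite /l2_dot -mulr2n -scaler_nat normrZ ger0_norm ?ler0n//; field.
Qed.

Lemma l2_dotDl f g h : l2_dot (f + g) h = l2_dot f h + l2_dot g h.
Proof. by rewrite l2_dotC l2_dotDr !(l2_dotC h). Qed.

Lemma l2_dotDB f g : l2_dot (f + g) (f - g) = `|f| ^+ 2 - `|g| ^+ 2.
Proof.
by rewrite l2_dotDl !l2_dotBr !l2_dotff (l2_dotC g f) addrA subrK.
Qed.

(** Cauchy-Schwarz: for a form defined by polarization it is the squared triangle inequality. *)
Lemma l2_dot_le f g : l2_dot f g <= `|f| * `|g|.
Proof.
rewrite /l2_dot ler_pdivrMr// -addrA -opprD lerBlDr.
have : `|f + g| ^+ 2 <= (`|f| + `|g|) ^+ 2.
  by rewrite ler_pXn2r ?nnegrE ?addr_ge0 ?ler_normD.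
by move=> /le_trans; apply; rewrite le_eqVlt; apply/orP; left; apply/eqP; ring.
Qed.

End l2_inner_product.

(** * The vector field of the equation *)

Section lattice_operators.
Context {R : realType}.
Implicit Types (f g h : l2 R) (z : Rcomplex R).

(* Multiplication by [- 'i]. *)
Definition rotc z : Rcomplex R := Complex (complex.Im z) (- complex.Re z).

Lemma norm_rotc z : `|rotc z| = `|z|.
Proof.
apply/eqP; rewrite -(@eqrXn2 _ 2)// !sqr_norm_Rcomplex /=.
by rewrite sqrrN addrC.
Qed.

Lemma l2_rot_subproof f : (fun n => rotc (f n)) \in sqr_summable.
Proof. by apply: (@l2_dominated _ 1 _ f) => // n; rewrite mul1r norm_rotc. Qed.
Definition l2_rot f : l2 R := L2 (l2_rot_subproof f).

Lemma sqr_sum_shift (k : int) (u : int -> Rcomplex R) :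
  sqr_sum (fun n => u (n + k)) = sqr_sum u.
Proof.
rewrite /sqr_sum [RHS](reindex_esum [set: int] [set: int] (fun n => n + k))//.
by split=> [//|m n _ _ /addIr//|n _]; exists (n - k) => //; rewrite subrK.
Qed.

Lemma l2_shift_subproof (k : int) f : (fun n => f (n + k)) \in sqr_summable.
Proof. by rewrite inE /= sqr_sum_shift -sqr_norm_l2 ltry. Qed.
Definition l2_shift (k : int) f : l2 R := L2 (l2_shift_subproof k f).

(** The sum over the two neighbours of a site, common to the discrete Laplacian and the cubic
    term. *)
Definition l2_hop f := l2_shift 1 f + l2_shift (-1) f.

Lemma l2_cubic_dominated f n :
  `| `|f n| ^+ 2 *: l2_hop f n| <= `|f| ^+ 2 * `|l2_hop f n|.
Proof.
rewrite RcomplexZ_norm ger0_norm ?sqr_ge0// ler_wpM2r//.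
by rewrite ler_pXn2r// ?nnegrE// le_coord_norm.
Qed.

Lemma l2_cubic_subproof f : (fun n => `|f n| ^+ 2 *: l2_hop f n) \in sqr_summable.
Proof. exact: (l2_dominated (sqr_ge0 _) (l2_cubic_dominated f)). Qed.
Definition l2_cubic f : l2 R := L2 (l2_cubic_subproof f).

Lemma norm_l2_shift (k : int) f : `|l2_shift k f| = `|f|.
Proof.
apply/eqP; rewrite -(@eqrXn2 _ 2)//; apply/eqP; apply: EFin_inj.
by rewrite !sqr_norm_l2 -[RHS](sqr_sum_shift k).
Qed.

Lemma norm_l2_hop f : `|l2_hop f| <= 2 * `|f|.
Proof.
by rewrite (le_trans (ler_normD _ _))// !norm_l2_shift mulr_natl.
Qed.

Lemma norm_l2_rot f : `|l2_rot f| = `|f|.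
Proof.
apply/le_anti/andP; split; rewrite -[leRHS]mul1r; apply: le_norm_l2 => // n;
  by rewrite mul1r norm_rotc.
Qed.

Lemma l2_rotD f g : l2_rot (f + g) = l2_rot f + l2_rot g.
Proof.
apply/val_inj/funext => n /=; rewrite !seq_combE /= /rotc !Rcomplex_combE.
by rewrite opprD.
Qed.

Lemma l2_rotN f : l2_rot (- f) = - l2_rot f.
Proof.
by apply/val_inj/funext => n /=; rewrite !seq_combE /= /rotc !Rcomplex_combE.
Qed.

Lemma l2_rotZ (a : R) f : l2_rot (a *: f) = a *: l2_rot f.
Proof.
apply/val_inj/funext => n /=; rewrite !seq_combE /= /rotc !Rcomplex_combE.
by rewrite -mulrN.
Qed.

Lemma l2_rot_rot f : l2_rot (l2_rot f) = - f.
Proof. by apply/val_inj/funext => n /=; rewrite seq_combE /rotc /=; case: (f n). Qed.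

Lemma l2_dot_rot f g : l2_dot (l2_rot f) (l2_rot g) = l2_dot f g.
Proof. by rewrite /l2_dot -l2_rotD !norm_l2_rot. Qed.

Lemma l2_shiftD (k : int) f g :
  l2_shift k (f + g) = l2_shift k f + l2_shift k g.
Proof. exact/val_inj. Qed.

Lemma l2_dot_shift (k : int) f g :
  l2_dot (l2_shift k f) (l2_shift k g) = l2_dot f g.
Proof.
by rewrite /l2_dot -l2_shiftD !norm_l2_shift.
Qed.

Lemma l2_rot_shift (k : int) f : l2_rot (l2_shift k f) = l2_shift k (l2_rot f).
Proof. exact/val_inj. Qed.

Lemma l2_shiftK (k : int) f : l2_shift k (l2_shift (- k) f) = f.
Proof. by apply/val_inj/funext => n /=; rewrite addrK. Qed.

(** [l2_rot] is an isometry with square [-1], hence skew-adjoint. *)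
Lemma l2_dot_rotr f g : l2_dot f (l2_rot g) = - l2_dot (l2_rot f) g.
Proof. by rewrite -l2_dot_rot l2_rot_rot l2_dotNr. Qed.

Lemma l2_dot_rot_self f : l2_dot f (l2_rot f) = 0.
Proof. by have := l2_dot_rotr f f; rewrite [l2_dot (l2_rot f) _]l2_dotC; lra. Qed.

(** The two opposite shifts are adjoint to each other and commute with [l2_rot], so their
    contributions cancel by skew-adjointness. *)
Lemma l2_dot_rot_hop f : l2_dot f (l2_rot (l2_hop f)) = 0.
Proof.
rewrite l2_rotD l2_dotDr -(l2_dot_shift 1 _ (l2_rot (l2_shift (-1) f))).
rewrite -l2_rot_shift l2_shiftK l2_dot_rotr.
by rewrite (l2_dotC (l2_shift _ _)) addNr.
Qed.

Lemma norm_l2_cubic f : `|l2_cubic f| <= 2 * `|f| ^+ 3.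
Proof.
have := @le_norm_l2 _ _ (l2_cubic f) _ (sqr_ge0 _) (l2_cubic_dominated f).
move=> /le_trans; apply.
by rewrite [_ ^+ 3]exprSr mulrCA ler_wpM2l ?sqr_ge0// norm_l2_hop.
Qed.

Lemma l2_hopB f g : l2_hop (f - g) = l2_hop f - l2_hop g.
Proof.
by apply/val_inj/funext => n; rewrite /= !seq_combE addrACA opprD.
Qed.

Lemma norm_l2_cubicB (q : R) f g : `|f| <= q -> `|g| <= q ->
  `|l2_cubic f - l2_cubic g| <= 6 * q ^+ 2 * `|f - g|.
Proof.
move=> fq gq; have q0 : 0 <= q by exact: le_trans fq.
(* The difference of the cubic terms is [u + v]; the two pieces contribute [2 * q ^+ 2] and
   [4 * q ^+ 2] to the Lipschitz constant. *)
pose u n := `|f n| ^+ 2 *: l2_hop (f - g) n.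
pose v n := (`|f n| ^+ 2 - `|g n| ^+ 2) *: l2_hop g n.
have cq h n : `|h| <= q -> `|h n| <= q by apply: le_trans; exact: le_coord_norm.
have uq n : `|u n| <= q ^+ 2 * `|l2_hop (f - g) n|.
  rewrite RcomplexZ_norm ger0_norm ?sqr_ge0// ler_wpM2r//.
  by rewrite ler_pXn2r// ?nnegrE// cq.
have vq n : `|v n| <= 4 * q ^+ 2 * `|(f - g) n|.
  rewrite RcomplexZ_norm subr_sqr normrM.
  rewrite [leRHS](_ : _ = `|(f - g) n| * (2 * q) * (2 * q)); last by ring.
  rewrite !ler_pM//.
  - exact: ler_dist_dist (f n) (g n).
  - by rewrite ger0_norm ?addr_ge0// mulr_natl mulr2n lerD ?cq.
  - apply: le_trans (le_coord_norm _ _) _.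
    by apply: le_trans (norm_l2_hop _) _; rewrite ler_pM2l.
have u2 := l2_dominated (sqr_ge0 q) uq.
have q4 : 0 <= 4 * q ^+ 2 by rewrite mulr_ge0 ?sqr_ge0.
have v2 := l2_dominated q4 vq.
have -> : l2_cubic f - l2_cubic g = L2 u2 + L2 v2.
  apply/val_inj/funext => n; rewrite /= !seq_combE /u /v l2_hopB.
  rewrite [l2_hop f - _]lock /= -lock !seq_combE.
  by rewrite scalerBr scalerBl addrA subrK.
apply: (le_trans (ler_normD _ _)).
have : `|L2 u2| <= q ^+ 2 * `|l2_hop (f - g)|.
  by apply: le_norm_l2 => //; rewrite sqr_ge0.
have : `|L2 v2| <= 4 * q ^+ 2 * `|f - g| by exact: le_norm_l2.
have : q ^+ 2 * `|l2_hop (f - g)| <= q ^+ 2 * (2 * `|f - g|).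
  by rewrite ler_wpM2l ?sqr_ge0// norm_l2_hop.
move: `|L2 u2| `|L2 v2| `|l2_hop _| `|f - g| => a b c d; lra.
Qed.

End lattice_operators.

Section vector_field.
Context {R : realType}.
Variables (delta mu : R) (g : l2 R).
Implicit Types (f h : l2 R).

(** The equation multiplied by [- 'i], that is, solved for the time derivative. *)
Definition dfAL_field f : l2 R :=
  l2_rot (l2_hop f - 2 *: f) + mu *: l2_rot (l2_cubic f) - delta *: f + l2_rot g.

Lemma dfAL_fieldE f n : dfAL_field f n =
  rotc (f (n + 1) + f (n - 1) - 2 *: f n) +
  mu *: rotc (`|f n| ^+ 2 *: (f (n + 1) + f (n - 1))) - delta *: f n + rotc (g n).
Proof. by []. Qed.

Lemma dfAL_eq_field f f' : dfAL_eq delta mu g f f' -> f' = dfAL_field f.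
Proof.
move=> eqf; apply/val_inj/funext => n.
rewrite [RHS]dfAL_fieldE sqr_norm_Rcomplex.
have := eqf n; rewrite -complexiE -add_Re2_Im2 /=.
case: (f' n) (f n) (g n) (f (n + 1)) (f (n - 1)) => [x' y'] [x y] [a b] [c d] [p q].
move=> /eqP; rewrite eq_complex /= => /andP[/eqP e1 /eqP e2].
rewrite /rotc; apply/eqP; rewrite eq_complex /=.
by apply/andP; split; apply/eqP; lra.
Qed.

Lemma l2_dot_schrodinger f : l2_dot f (l2_rot (l2_hop f - 2 *: f)) = 0.
Proof.
by rewrite l2_rotD l2_rotN l2_rotZ l2_dotBr l2_dot_rot_hop l2_dotZr
  l2_dot_rot_self mulr0 subrr.
Qed.

Lemma l2_dot_field f : 0 <= mu ->
  l2_dot f (dfAL_field f) <= 2 * mu * `|f| ^+ 4 - delta * `|f| ^+ 2 + `|g| * `|f|.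
Proof.
move=> mu0; rewrite /dfAL_field l2_dotDr l2_dotBr l2_dotDr l2_dot_schrodinger.
rewrite !l2_dotZr l2_dotff add0r lerD//; last first.
  by rewrite (le_trans (l2_dot_le _ _))// norm_l2_rot mulrC.
rewrite lerD2r mulrAC (mulrC _ mu) ler_wpM2l// (le_trans (l2_dot_le _ _))//.
by rewrite norm_l2_rot [_ ^+ 4]exprS mulrCA ler_wpM2l// norm_l2_cubic.
Qed.

(** The forcing cancels in the difference and the discrete Schrodinger part is orthogonal to
    [f - h]; only the damping and the Lipschitz bound on the cubic term remain. *)
Lemma l2_dot_fieldB (q : R) f h : 0 <= mu -> `|f| <= q -> `|h| <= q ->
  l2_dot (f - h) (dfAL_field f - dfAL_field h) <=
    (6 * mu * q ^+ 2 - delta) * `|f - h| ^+ 2.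
Proof.
move=> mu0 fq hq.
have -> : dfAL_field f - dfAL_field h =
    l2_rot (l2_hop (f - h) - 2 *: (f - h)) +
    mu *: l2_rot (l2_cubic f - l2_cubic h) - delta *: (f - h).
  rewrite /dfAL_field l2_hopB !(l2_rotD, l2_rotN, scalerBr, l2_rotZ, opprD, opprK).
  by apply/val_inj/funext => n; rewrite /= !seq_combE; ring.
have dotN : l2_dot (f - h) (l2_rot (l2_cubic f - l2_cubic h)) <=
    6 * q ^+ 2 * `|f - h| ^+ 2.
  rewrite (le_trans (l2_dot_le _ _))// norm_l2_rot [X in _ <= _ * X]expr2 mulrCA.
  by rewrite ler_wpM2l// norm_l2_cubicB.
rewrite l2_dotBr l2_dotDr l2_dot_schrodinger !l2_dotZr l2_dotff add0r.
by have := ler_wpM2l mu0 dotN; rewrite mulrBl; lra.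
Qed.

End vector_field.

(** * Differential inequalities for the squared norm *)

Lemma cvg_withinS (T : Type) (F : set_system T) {FF : Filter F} (A B : set T) :
  A `<=` B -> within A F --> within B F.
Proof. by move=> AB P; apply: (@filterS _ F FF) => x BP /AB /BP. Qed.

Section half_line_calculus.
Context {R : realType}.
Implicit Types (u v : R -> l2 R).

(** The differentiability clause of [C1_half_line], isolated because it passes to differences and
    time shifts of curves. *)
Definition half_line_derivative u v := forall t : R, 0 <= t ->
  h^-1 *: (u (t + h) - u t) @[h --> within [set h | 0 <= t + h] 0^'] --> v t.

Lemma half_line_derivativeB u1 v1 u2 v2 :
  half_line_derivative u1 v1 -> half_line_derivative u2 v2 ->
  half_line_derivative (u1 \- u2) (v1 \- v2).
Proof.
move=> d1 d2 t t0 /=.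
under eq_fun do rewrite opprD addrACA -opprD scalerBr.
exact: cvgB (d1 t t0) (d2 t t0).
Qed.

Lemma half_line_derivative_shift (s : R) u v : 0 <= s ->
  half_line_derivative u v ->
  half_line_derivative (fun t => u (t + s)) (fun t => v (t + s)).
Proof.
move=> s0 d t t0; have := d (t + s) (addr_ge0 t0 s0).
under eq_fun do rewrite addrAC.
apply: cvg_trans; apply: cvg_app; apply: cvg_withinS => h /= th.
by rewrite addrAC addr_ge0.
Qed.

(** The increment is [h] times the difference quotient, and the latter converges. *)
Lemma half_line_continuous u v (t : R) : half_line_derivative u v -> 0 <= t ->
  u (t + h) @[h --> within [set h | 0 <= t + h] 0^'] --> u t.
Proof.
move=> d t0.
have FF : Filter (within [set h | 0 <= t + h] (0 : R)^') by exact: within_filter.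
have h0 : h @[h --> within [set h | 0 <= t + h] 0^'] --> (0 : R).
  move=> A A0.
  suff : \forall h \near (0 : R), h != 0 -> 0 <= t + h -> A h by [].
  by apply: (@filterS _ (nbhs (0 : R)) _ A) A0.
have := cvgD (cvgZ h0 (d t t0)) (cvg_cst (u t)).
rewrite scale0r add0r => /(_ FF FF FF); apply: cvg_trans; apply: near_eq_cvg.
have : \forall h \near (0 : R), h != 0 -> 0 <= t + h ->
    h *: (h^-1 *: (u (t + h) - u t)) + u t = u (t + h).
  by apply: (@nearW _ (nbhs (0 : R))) => h h0' _; rewrite scalerA divff// scale1r subrK.
exact.
Qed.

Lemma cvg_l2_dot (T : Type) (F : set_system T) {FF : ProperFilter F}
    (f g : T -> l2 R) (a b : l2 R) :
  f @ F --> a -> g @ F --> b -> l2_dot (f x) (g x) @[x --> F] --> l2_dot a b.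
Proof.
move=> fa gb; apply: cvgM; last exact: cvg_cst.
have sq (w : T -> l2 R) c : w @ F --> c -> `|w x| ^+ 2 @[x --> F] --> `|c| ^+ 2.
  by move=> wc; apply: cvgM; exact: cvg_norm.
by apply: cvgB; [apply: cvgB|]; apply: sq => //; exact: cvgD.
Qed.

(** At an interior time the constraint on the increments holds near 0. By [l2_dotDB] the quotient of
    the squared norm is the product of [u (t + h) + u t] with the quotient of [u]. *)
Lemma is_derive_sqr_norm u v (t : R) : half_line_derivative u v -> 0 < t ->
  is_derive t 1 (fun s => `|u s| ^+ 2) (2 * l2_dot (u t) (v t)).
Proof.
move=> d t0.
have nA : \forall h \near (0 : R)^', 0 <= t + h.
  apply: filterS (dnbhs0_lt t0) => h /ltW.
  by rewrite ler_norml -subr_ge0 opprK addrC => /andP[].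
have sub : (0 : R)^' `=>` within [set h | 0 <= t + h] (0 : R)^'.
  by move=> A; apply: (@filterS2 _ (0 : R)^') nA => h /[swap]; apply.
have quot := cvg_trans (cvg_app _ sub) (d t (ltW t0)).
have cont := cvg_trans (cvg_app _ sub) (half_line_continuous d (ltW t0)).
suff : h^-1 *: (`|u (h *: 1 + t)| ^+ 2 - `|u t| ^+ 2) @[h --> (0 : R)^'] -->
    2 * l2_dot (u t) (v t).
  by move=> H; apply: DeriveDef; [apply/cvg_ex; eexists; exact: H|exact: cvg_lim H].
have PF : ProperFilter (0 : R)^' by exact: Proper_dnbhs_numFieldType.
have /(_ PF PF PF) := cvg_l2_dot (cvgD cont (cvg_cst (u t))) quot.
rewrite l2_dotDl -mulr2n -[_ *+ 2]mulr_natl; apply: cvg_trans; apply: near_eq_cvg.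
apply: nearW => h; rewrite l2_dotZr l2_dotDB.
by rewrite [h%:A]mulr1 [h + t]addrC.
Qed.

Lemma cvg_sqr_norm_at_right u v : half_line_derivative u v ->
  `|u s| ^+ 2 @[s --> 0^'+] --> `|u 0| ^+ 2.
Proof.
move=> d; have cont := half_line_continuous d (lexx 0).
have sub : (0 : R)^'+ `=>` within [set h | 0 <= 0 + h] (0 : R)^'.
  move=> A; rewrite /at_right /within /= => nA.
  apply: (@filterS _ (nbhs (0 : R))) nA => h hA h0.
  by apply: hA; [rewrite gt_eqF|rewrite add0r ltW].
have := cvg_trans (cvg_app _ sub) cont.
under eq_fun do rewrite add0r.
by move=> uc; apply: cvgM; exact: cvg_norm.
Qed.

Lemma gronwall_sqr_norm u v (k a T : R) : half_line_derivative u v -> 0 <= T ->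
  (forall t, 0 < t < T -> 2 * l2_dot (u t) (v t) <= - k * (`|u t| ^+ 2 - a)) ->
  `|u T| ^+ 2 - a <= expR (- k * T) * (`|u 0| ^+ 2 - a).
Proof.
move=> d; rewrite le_eqVlt => /orP[/eqP <- _|T0 ineq].
  by rewrite mulr0 expR0 mul1r.
(* Integrating factor: the hypothesis says that [F] has nonpositive derivative on the open interval;
   continuity at both ends then gives [F T <= F 0]. *)
pose F (t : R) := expR (k * t) * (`|u t| ^+ 2 - a).
have dE (t : R) : is_derive t (1 : R) (fun s => expR (k * s)) (expR (k * t) * k).
  apply: (@is_derive1_comp _ expR (fun s => k * s)).
  by apply: is_derive_eq; rewrite [k%:A]mulr1.
have dF (t : R) : 0 < t -> is_derive t (1 : R) F
    (expR (k * t) * (2 * l2_dot (u t) (v t) + k * (`|u t| ^+ 2 - a))).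
  move=> t0; have du := is_derive_sqr_norm d t0.
  have := is_deriveM (dE t) (is_deriveB du (is_derive_cst a t (1 : R))).
  rewrite subr0 => dF; apply: is_derive_eq dF _.
  by rewrite mulrDr; congr (_ + _); rewrite -[_ *: _]mulrC mulrA.
have cE : continuous (fun s => expR (k * s)).
  by move=> t; apply/differentiable_continuous/derivable1_diffP; case: (dE t).
have cF (t : R) : 0 < t -> {for t, continuous F}.
  move=> /dF[dFt _]; exact/differentiable_continuous/derivable1_diffP.
have : F T <= F 0.
  apply: (@ler0_derive1_le_cc _ F 0 T) => //.
  - by move=> t; rewrite in_itv /= => /andP[t0 _]; case: (dF t t0).
  - move=> t; rewrite in_itv /= => t0T; have /andP[t0 tT] := t0T.
    rewrite derive1E; have [_ ->] := dF t t0.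
    by rewrite pmulr_rle0 ?expR_gt0// -lerBrDr sub0r -mulNr ineq.
  - apply/continuous_within_itvP => //; split.
    + by move=> t; rewrite in_itv /= => /andP[t0 _]; exact: cF.
    + apply: cvgM; first exact: cvg_at_right_filter (cE 0).
      by apply: cvgB; [exact: cvg_sqr_norm_at_right d|exact: cvg_cst].
    + by apply: cvg_at_left_filter; exact: cF.
  - by rewrite in_itv /= lexx ltW.
  - by rewrite in_itv /= lexx ltW.
  - exact: ltW.
by rewrite /F mulr0 expR0 mul1r mulNr expRN -ler_pdivlMl ?invr_gt0 ?expR_gt0// invrK.
Qed.

End half_line_calculus.

(** * Completeness of l2 *)

Section l2_completeness.
Context {R : realType}.
Implicit Types (f g p : l2 R).

Lemma cauchy_l2_close (F : set_system (l2 R)) : ProperFilter F -> cauchy F ->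
  forall e : R, 0 < e ->
  exists2 A, F A & forall f g, A f -> A g -> `|f - g| <= e.
Proof.
move=> FF /cauchy_ballP Fc e e0; have [[A B] /= [FA FB] AB] := Fc e e0.
exists (A `&` B); first exact: filterI.
move=> f g [Af _] [_ Bg]; have := AB (f, g); rewrite /= -ball_normE /= => AB'.
exact/ltW/AB'.
Qed.

Lemma lipschitz_cauchy_cvg (F : set_system (l2 R)) (phi : l2 R -> R) :
  ProperFilter F -> cauchy F ->
  (forall f g, `|phi f - phi g| <= `|f - g|) -> cvg (phi f @[f --> F]).
Proof.
move=> FF Fc phi1; apply/cauchy_cvgP/cauchy_ballP => e e0.
have [A FA Ae] := cauchy_l2_close FF Fc (divr_gt0 e0 (ltr0Sn R 1)).
exists (phi @` A, phi @` A) => /=.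
  by split; apply: (@filterS _ F _ A) FA => f Af; exists f.
move=> [_ _] [/= [f Af <-] [g Ag <-]]; rewrite -ball_normE /=.
apply: (le_lt_trans (phi1 f g)); apply: (le_lt_trans (Ae f g Af Ag)).
by rewrite ltr_pdivrMr ?ltr_pMr ?ltr1n.
Qed.

Lemma fsum_sqr_norm_le (A : set int) (f : l2 R) : finite_set A ->
  \sum_(n <- fset_set A) `|f n| ^+ 2 <= `|f| ^+ 2.
Proof.
move=> finA; rewrite -lee_fin sqr_norm_l2 -sumEFin -fsbig_finite//.
by apply: ereal_sup_ubound; exists A.
Qed.

(** The candidate limit [p] is taken coordinatewise; finite partial sums pass to the limit along
    [F], and their supremum controls the full norm. *)
Lemma l2_complete (F : set_system (l2 R)) : ProperFilter F -> cauchy F -> cvg F.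
Proof.
move=> FF Fc.
pose p n : Rcomplex R := Complex (lim ((fun f : l2 R => complex.Re (f n)) @ F))
  (lim ((fun f : l2 R => complex.Im (f n)) @ F)).
have cvgRe n : (fun f : l2 R => complex.Re (f n)) @ F --> complex.Re (p n).
  apply: lipschitz_cauchy_cvg => // f g.
  rewrite -(Re_Rcomplex_combE.1.2 (g n)) -Re_Rcomplex_combE.
  exact: le_trans (Re_le_norm _) (le_coord_norm (f - g) n).
have cvgIm n : (fun f : l2 R => complex.Im (f n)) @ F --> complex.Im (p n).
  apply: lipschitz_cauchy_cvg => // f g.
  rewrite -(Im_Rcomplex_combE.1.2 (g n)) -Im_Rcomplex_combE.
  exact: le_trans (Im_le_norm _) (le_coord_norm (f - g) n).
have bound f (e : R) : 0 <= e -> (\forall g \near F, `|f - g| <= e) ->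
    (sqr_sum (fun n => f n - p n)%R <= (e ^+ 2)%:E)%E.
  move=> e0 fe; apply: ge_ereal_sup => _ [A [finA _] <-].
  rewrite fsbig_finite// sumEFin lee_fin.
  have : (fun g : l2 R => \sum_(n <- fset_set A) `|f n - g n| ^+ 2) @ F -->
      \sum_(n <- fset_set A) `|f n - p n| ^+ 2.
    apply: cvg_big => [|n _]; first exact: add_continuous.
    rewrite sqr_norm_Rcomplex !Rcomplex_combE.
    under eq_fun do rewrite sqr_norm_Rcomplex !Rcomplex_combE.
    by apply: cvgD; apply: cvgM; apply: cvgB => //; exact: cvg_cst.
  move=> /cvgr_to_le; apply; apply: (@filterS _ F) fe => g fge.
  apply: (le_trans (fsum_sqr_norm_le (f - g) finA)).
  by rewrite ler_pXn2r ?nnegrE.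
have [A FA A1] := cauchy_l2_close FF Fc ltr01.
have [f0 Af0] := filter_ex FA.
have f0p : (fun n => f0 n - p n) \in sqr_summable.
  rewrite inE /=; apply: (le_lt_trans (bound f0 1 ler01 _)); last exact: ltry.
  by apply: filterS FA => g; exact: A1.
(* The sequence [p] as an element of l2: it differs from [f0] by a square-summable sequence. *)
pose q : l2 R := f0 - L2 f0p.
have qp n : q n = p n by rewrite /q /= !seq_combE opprB addrC subrK.
apply/cvg_ex; exists q; apply/cvgrPdist_le => e e0.
have [B FB Be] := cauchy_l2_close FF Fc e0.
apply: filterS (FB) => f Bf; rewrite distrC.
rewrite -(@ler_pXn2r _ 2)// ?nnegrE ?(ltW e0)// -lee_fin sqr_norm_l2.
have -> : sqr_sum (f - q) = sqr_sum (fun n => f n - p n).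
  by congr sqr_sum; apply/funext => n; rewrite -qp.
apply: bound; first exact: ltW.
by apply: filterS FB => g; exact: Be.
Qed.

HB.instance Definition _ := Uniform_isComplete.Build (l2 R) l2_complete.

End l2_completeness.

(** * Energy and contraction estimates *)

Section trajectories.
Context {R : realType}.
Variables (delta mu : R) (g : l2 R).
Implicit Types (psi phi : R -> l2 R).

Definition dfAL_curve psi :=
  half_line_derivative psi (fun t => dfAL_field delta mu g (psi t)).

Lemma dfAL_solution_curve u0 psi : dfAL_solution delta mu g u0 psi ->
  psi 0 = u0 /\ dfAL_curve psi.
Proof.
move=> [psi00 [dpsi [_ d] e]]; split => // t t0.
by rewrite -(dfAL_eq_field (e t t0)); exact: d.
Qed.

Lemma dfAL_curve_shift (s : R) psi : 0 <= s -> dfAL_curve psi ->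
  dfAL_curve (fun t => psi (t + s)).
Proof. by move=> s0; exact: half_line_derivative_shift. Qed.

Lemma norm_decay (q T : R) psi : 0 <= mu -> dfAL_curve psi -> 0 <= T ->
  (forall t, 0 < t < T -> `|psi t| <= q) ->
  let k := delta - 2 * mu * q ^+ 2 in 0 < k ->
  `|psi T| ^+ 2 - (`|g| / k) ^+ 2 <=
    expR (- k * T) * (`|psi 0| ^+ 2 - (`|g| / k) ^+ 2).
Proof.
move=> mu0 dpsi T0 psiq k k0; apply: (gronwall_sqr_norm dpsi T0) => t t0T.
have := l2_dot_field delta g (psi t) mu0.
have q0 : 0 <= q by apply: le_trans (psiq t t0T).
have : `|psi t| ^+ 2 <= q ^+ 2 by rewrite ler_pXn2r ?nnegrE ?psiq.
move: (l2_dot _ _) => D; move: `|psi t| `|g| => m G mq DE.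
have gk : k * (G / k) ^+ 2 = G ^+ 2 / k.
  by rewrite expr_div_n; field; rewrite gt_eqF.
(* Young's inequality: half of the damping [2 * k * m ^+ 2] absorbs the forcing, the other half
   gives the decay rate [k]. *)
have yng : 2 * (G * m) <= k * m ^+ 2 + k * (G / k) ^+ 2.
  rewrite -subr_ge0; have -> : k * m ^+ 2 + k * (G / k) ^+ 2 - 2 * (G * m) =
      k * (m - G / k) ^+ 2 by field; rewrite gt_eqF.
  by rewrite mulr_ge0 ?sqr_ge0 ?ltW.
have : mu * m ^+ 4 <= mu * q ^+ 2 * m ^+ 2.
  by rewrite -mulrA ler_wpM2l// (exprM m 2 2) expr2 ler_wpM2r ?sqr_ge0.
rewrite /k in yng *; lra.
Qed.

(** Continuity argument: the decay estimate assumes the bound [q] and returns the stronger bound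
    [a], so the solution cannot cross the gap between them. *)
Lemma norm_trap (q a : R) psi : 0 <= mu -> dfAL_curve psi ->
  let k := delta - 2 * mu * q ^+ 2 in 0 < k ->
  `|g| / k <= a -> a < q -> `|psi 0| <= a ->
  forall T, 0 <= T -> `|psi T| <= a.
Proof.
move=> mu0 dpsi k k0 ga aq psi0 T T0; rewrite leNgt; apply/negP => aT.
have a0 : 0 <= a by exact: le_trans psi0.
have gk0 : 0 <= `|g| / k by rewrite divr_ge0// ltW.
have decay t : 0 <= t -> (forall s, 0 < s < t -> `|psi s| <= q) -> `|psi t| <= a.
  move=> t0 psiq; rewrite -(@ler_pXn2r _ 2)// ?nnegrE//.
  have /(_ k0) := norm_decay mu0 dpsi t0 psiq; rewrite -/k.
  have ga2 : (`|g| / k) ^+ 2 <= a ^+ 2 by rewrite ler_pXn2r ?nnegrE.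
  have psi02 : `|psi 0| ^+ 2 <= a ^+ 2 by rewrite ler_pXn2r ?nnegrE.
  have e1 : expR (- k * t) <= 1 by rewrite expR_le1 mulNr oppr_le0 mulr_ge0// ltW.
  have e0 := expR_ge0 (- k * t).
  rewrite -subr_ge0 in e1.
  have := ler_wpM2l e0 psi02; have := ler_wpM2l e1 ga2.
  move: (expR _) (a ^+ 2) (`|psi t| ^+ 2) (`|psi 0| ^+ 2) (_ ^+ 2) => *; lra.
(* The times up to which the bound [a] holds; the assumed violation at [T] bounds this set. Its
   supremum [t0] will be exceeded by [t0 + e / 2]. *)
pose D := [set t : R | 0 <= t /\ forall s, 0 <= s <= t -> `|psi s| <= a].
have D0 : D 0 by split=> // s /le_anti <-.
have DT : ubound D T.
  move=> t [t0 Dt]; rewrite leNgt; apply/negP => Tt.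
  by have := Dt T; rewrite T0 ltW// leNgt aT => /(_ isT).
have supD : has_sup D by split; [exists 0|exists T].
pose t0 := sup D.
have t00 : 0 <= t0 by apply: ub_le_sup => //; exists T.
have below s : 0 <= s -> s < t0 -> `|psi s| <= a.
  move=> s0 st; have [t [_ Dt] lt_st] := sup_gt (ex_intro _ _ D0) st.
  by apply: Dt; rewrite s0 ltW.
have at0 : `|psi t0| <= a.
  apply: decay => // s /andP[s0 st]; apply: (le_trans _ (ltW aq)).
  by apply: below => //; exact: ltW.
have : \forall h \near within [set h | 0 <= t0 + h] 0^', `|psi (t0 + h)| < q.
  have := half_line_continuous dpsi t00.
  move=> /cvg_norm /cvgr_lt; apply; exact: le_lt_trans at0 aq.
move=> [e /= e0 He].
have near0 s : t0 <= s -> s < t0 + e -> `|psi s| <= q.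
  rewrite le_eqVlt => /orP[/eqP <- _|ts se]; first exact: (le_trans _ (ltW aq)).
  have d0 : 0 < s - t0 by rewrite subr_gt0.
  have := He (s - t0); rewrite /= sub0r normrN gtr0_norm// ltrBlDl subrKC.
  move=> /(_ se) lt_q; apply/ltW/lt_q; first by rewrite gt_eqF.
  exact: le_trans t00 (ltW ts).
have : D (t0 + e / 2).
  split=> [|s /andP[s0 se]]; first by rewrite addr_ge0// divr_ge0// ltW.
  apply: decay => // s' /andP[s'0 s's].
  have [t0s'|s't0] := leP t0 s'; last first.
    by apply: (le_trans _ (ltW aq)); apply: below => //; exact: ltW.
  apply: near0 => //; apply: (lt_le_trans s's); apply: (le_trans se).
  by rewrite lerD2l ler_pdivrMr// ler_peMr ?ler1n// ltW.
move=> /(ub_le_sup (ex_intro _ T DT)).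
by rewrite -/t0 gerDl leNgt divr_gt0.
Qed.

(** Gronwall with offset 0 and rate [2 * c] for the squared distance. With equal initial values it
    also gives uniqueness. *)
Lemma curve_contraction (q T : R) psi phi : 0 <= mu ->
  dfAL_curve psi -> dfAL_curve phi -> 0 <= T ->
  (forall t, 0 < t < T -> `|psi t| <= q) ->
  (forall t, 0 < t < T -> `|phi t| <= q) ->
  `|psi T - phi T| <=
    expR (- (delta - 6 * mu * q ^+ 2) * T) * `|psi 0 - phi 0|.
Proof.
move=> mu0 dpsi dphi T0 psiq phiq; set c := delta - _.
have d := half_line_derivativeB dpsi dphi.
have : `|psi T - phi T| ^+ 2 - 0 <=
    expR (- (2 * c) * T) * (`|psi 0 - phi 0| ^+ 2 - 0).
  apply: (gronwall_sqr_norm d T0) => t t0T /=.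
  have := l2_dot_fieldB delta g mu0 (psiq t t0T) (phiq t t0T).
  by rewrite subr0 /c; move: (l2_dot _ _) (`|_| ^+ 2) => D w; lra.
have -> : expR (- (2 * c) * T) = expR (- c * T) ^+ 2.
  by rewrite -expRM_natl; congr expR; ring.
by rewrite !subr0 -exprMn ler_pXn2r// nnegrE ?mulr_ge0 ?expR_ge0//.
Qed.

End trajectories.

(** * The attractor *)

Lemma expR_decay_cvg (R : realType) (k C : R) : 0 < k ->
  expR (- k * t) * C @[t --> +oo] --> 0.
Proof.
move=> k0; rewrite -[X in _ --> X](mul0r C); apply: cvgM; last exact: cvg_cst.
under eq_fun do rewrite mulNr.
have kt : k * t @[t --> +oo] --> +oo by apply: gt0_cvgMry => //; exact: cvg_id.
exact: (cvg_comp _ _ kt (@cvgr_expR R)).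
Qed.

Lemma expR_decay_le0 (R : realType) (k C x : R) : 0 < k ->
  (forall t, 0 <= t -> x <= expR (- k * t) * C) -> x <= 0.
Proof.
move=> k0 xC; apply: (cvgr_to_ge (expR_decay_cvg C k0)).
by near=> t; apply: xC; near: t; exact: nbhs_pinfty_ge.
Unshelve. all: by end_near. Qed.

Section attractor.
Context {R : realType}.
Variables (delta mu : R) (g : l2 R) (S : R -> l2 R -> l2 R) (Rmu : R).
Hypotheses (mu_ge0 : 0 <= mu) (S_dfAL : dfAL_semigroup delta mu g S).
Hypothesis Rmu_gt0 : 0 < Rmu.
Let k := delta - 2 * mu * Rmu ^+ 2.
Hypotheses (k_gt0 : 0 < k) (g_small : `|g| / k < Rmu / 2).

(** Halving the radius leaves room for [norm_trap] below [Rmu] and lowers the Lipschitz constant of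
    the cubic part to [3 / 2 * mu * Rmu ^+ 2]. *)
Let U := [set f : l2 R | `|f| <= Rmu / 2].
Let c := delta - 6 * mu * (Rmu / 2) ^+ 2.

Let closedU : closed U.
Proof.
apply: (@closed_comp _ _ (fun f : l2 R => `|f|) [set x | x <= Rmu / 2]).
  by move=> f _; exact: norm_continuous.
exact: closed_le.
Qed.

Let S0 u : S 0 u = u.
Proof. by have [] := dfAL_solution_curve (S_dfAL u). Qed.

Let S_curve u : dfAL_curve delta mu g (S ^~ u).
Proof. by have [] := dfAL_solution_curve (S_dfAL u). Qed.

Let half_lt : Rmu / 2 < Rmu.
Proof. by rewrite ltr_pdivrMr// ltr_pMr// ltr1n. Qed.

Let S_trap t u : 0 <= t -> U u -> U (S t u).
Proof.
move=> t0 Uu; apply: (norm_trap mu_ge0 (@S_curve u) k_gt0 (ltW g_small) half_lt) => //.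
by rewrite S0.
Qed.

Let S_contraction t u w : 0 <= t -> U u -> U w ->
  `|S t u - S t w| <= expR (- c * t) * `|u - w|.
Proof.
move=> t0 Uu Uw; rewrite -{2}(S0 u) -{2}(S0 w).
apply: (curve_contraction mu_ge0 (@S_curve u) (@S_curve w) t0) => s /andP[s0 _];
  by apply: S_trap => //; exact: ltW.
Qed.

(** As functions of [s], both sides are curves in [U] with the same initial point, so their distance
    is bounded by a multiple of 0. *)
Let S_add s t u : 0 <= s -> 0 <= t -> U u -> S (s + t) u = S s (S t u).
Proof.
move=> s0 t0 Uu; apply/eqP; rewrite -subr_eq0 -normr_le0.
have := curve_contraction mu_ge0 (dfAL_curve_shift t0 (@S_curve u))
  (@S_curve (S t u)) s0 (q := Rmu / 2).
rewrite add0r S0 subrr normr0 mulr0; apply => r /andP[r0 _].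
  by apply: S_trap => //; rewrite addr_ge0// ltW.
by apply: S_trap; [exact: ltW|exact: S_trap].
Qed.

Hypothesis c_gt0 : 0 < c.

Lemma dfAL_equilibrium : exists2 p, U p & forall t, 0 <= t -> S t p = p.
Proof.
have S1U : {homo S 1 : u / U u >-> U u} by move=> u; exact: S_trap.
have e1 : expR (- c) < 1 by rewrite expR_lt1 oppr_lt0.
have ctr : is_contraction [fun of mkfun S1U].
  exists (NngNum (expR_ge0 (- c))); split => // -[u w] /= [Uu Uw].
  by have := S_contraction ler01 Uu Uw; rewrite mulr1.
have U0 : U !=set0 by exists 0; rewrite /U /= normr0 divr_ge0// ltW.
have [p Up Sp] := banach_fixed_point ctr closedU U0.
have {}Sp : p = S 1 p := Sp.
exists p => // t t0; apply/eqP; rewrite -subr_eq0 -normr_le0.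
(* [S t] commutes with [S 1], so [S t p] is also fixed by the contraction [S 1], which forces
   [S t p = p]. *)
have : `|S t p - p| <= expR (- c) * `|S t p - p|.
  have := S_contraction ler01 (S_trap t0 Up) Up.
  by rewrite mulr1 -S_add// [1 + t]addrC S_add// -Sp.
by rewrite -subr_le0 -[X in X - _]mul1r -mulrBl pmulr_rle0 ?subr_gt0.
Qed.

Lemma restricted_attractor_small (A : set (l2 R)) a :
  restricted_global_attractor S Rmu A -> A a -> `|a| <= `|g| / k.
Proof.
move=> [V [_ _ VR _ [AV SA _ _ _]]] Aa.
have AR b : A b -> `|b| < Rmu.
  by move=> /AV /VR; rewrite -ball_normE /= sub0r normrN.
rewrite -(@ler_pXn2r _ 2)// ?nnegrE ?divr_ge0 ?(ltW k_gt0)// -subr_le0.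
apply: (@expR_decay_le0 _ k (Rmu ^+ 2)) => // t t0.
(* Invariance lets [a] be reached from [A] after an arbitrarily long time [t], along a trajectory
   that stays in [A]. *)
have [b Ab <-] : (S t @` A) a by rewrite SA.
have SAb s : 0 <= s -> A (S s b) by move=> s0; rewrite -(SA s s0); exists b.
have := @norm_decay _ _ _ g Rmu t (S ^~ b) mu_ge0 (@S_curve b) t0.
rewrite -/k => /(_ _ k_gt0) decay; apply: (le_trans (decay _)).
  by move=> s /andP[s0 _]; apply/ltW/AR/SAb/ltW.
rewrite ler_wpM2l ?expR_ge0// S0 lerBlDr (@le_trans _ _ (Rmu ^+ 2))//.
  by rewrite ler_pXn2r ?nnegrE ?(ltW Rmu_gt0)// ltW// AR.
by rewrite lerDl sqr_ge0.
Qed.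

Lemma equilibrium_attractor p : U p -> (forall t, 0 <= t -> S t p = p) ->
  restricted_global_attractor S Rmu [set p].
Proof.
move=> Up Sp; exists U; split.
- exact: closedU.
- by exists p.
- by move=> f Uf; rewrite -ball_normE /= sub0r normrN (le_lt_trans Uf).
- split=> [t t0 _ [u Uu <-]| |]; [exact: S_trap|by []|].
  by move=> s t u s0 t0 Uu; exact: S_add.
split.
- by move=> _ ->.
- by move=> t t0; rewrite image_set1 Sp.
- exact: compact_set1.
- by exists p.
move=> B BU _.
(* Two points of [U] are at most [Rmu] apart, so this bound on the distance to [p] is uniform over
   [B]. *)
have lim0 : (expR (- c * t) * Rmu)%:E @[t --> +oo] --> 0%:E.
  apply: cvg_EFin; first exact: nearW.
  exact: expR_decay_cvg.
apply: (squeeze_cvge _ (cvg_cst 0%E) lim0).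
near=> t; have t0 : 0 <= t by near: t; exact: nbhs_pinfty_ge.
apply/andP; split; first by rewrite /dist le_max lexx.
rewrite /dist ge_max lee_fin mulr_ge0 ?expR_ge0 ?(ltW Rmu_gt0)//=.
apply: ge_ereal_sup => _ [_ [b Bb <-] <-].
apply: (@le_trans _ _ (`|S t b - p|)%:E).
  by apply: ereal_inf_lbound; exists p.
rewrite lee_fin -{1}(Sp t t0); apply: (le_trans (S_contraction t0 (BU b Bb) Up)).
rewrite ler_wpM2l ?expR_ge0// (le_trans (ler_normB _ _))//.
have := BU b Bb; have := Up; rewrite /U /=; lra.
Unshelve. all: by end_near. Qed.

(** The norm bound places [A] inside [U] whatever set it attracts; contraction along arbitrarily
    long trajectories then collapses it to [p], and nonemptiness gives equality. *)
Lemma restricted_attractor_unique p (A : set (l2 R)) :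
  U p -> (forall t, 0 <= t -> S t p = p) ->
  restricted_global_attractor S Rmu A -> A = [set p].
Proof.
move=> Up Sp rA; have [V [_ _ _ _ [_ SA _ [a0 Aa0] _]]] := rA.
have AU b : A b -> U b.
  by move=> /(restricted_attractor_small rA) /le_trans; apply; exact: ltW.
have Ap a : A a -> a = p.
  move=> Aa; apply/eqP; rewrite -subr_eq0 -normr_le0.
  apply: (@expR_decay_le0 _ c Rmu) => // t t0.
  have [b Ab <-] : (S t @` A) a by rewrite SA.
  rewrite -{1}(Sp t t0); apply: (le_trans (S_contraction t0 (AU b Ab) Up)).
  rewrite ler_wpM2l ?expR_ge0// (le_trans (ler_normB _ _))//.
  have := AU b Ab; have := Up; rewrite /U /=; lra.
by apply/seteqP; split=> [a /Ap|_ ->]//; rewrite -(Ap a0).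
Qed.

End attractor.

(** * Smallness conditions and conclusion *)

Unset Implicit Arguments.

Theorem mainTheorem3 (R : realType) (delta mu : R) (g : l2 R)
    (Rmu rho r : R) (psi0 : l2 R) (S : R -> l2 R -> l2 R) :
  0 < delta -> 0 < mu ->
  ((delta ^+ 2)%:E <
     3%:E * \esum_(n in [set: int]) (`|g n| `^ (4 / 3))%:E)%E ->
  0 < Rmu -> Rmu ^+ 2 < delta / (4 * mu) ->
  0 < `|psi0| ^+ 2 <= Rmu ^+ 2 ->
  0 <= rho ->
  rho ^+ 2 = 4 / delta * (`|g| ^+ 2 / (delta - 4 * mu * Rmu ^+ 2)) ->
  rho < r < Rmu ->
  dfAL_semigroup delta mu g S ->
  exists A : set (l2 R),
    unique (restricted_global_attractor S Rmu) A /\ A `<=` ball (0 : l2 R) r.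
Proof.
move=> delta0 mu0 _ Rmu0 Rmu_small _ rho0 rhoE /andP[rho_r r_Rmu] S_dfAL.
rewrite ltr_pdivlMr ?mulr_gt0// in Rmu_small.
set x := mu * Rmu ^+ 2.
have x0 : 0 <= x by rewrite mulr_ge0 ?sqr_ge0// ltW.
have x4 : 4 * x < delta by rewrite /x; lra.
have kE : delta - 2 * mu * Rmu ^+ 2 = delta - 2 * x by rewrite /x; ring.
have k0 : 0 < delta - 2 * mu * Rmu ^+ 2 by rewrite kE; lra.
have c0 : 0 < delta - 6 * mu * (Rmu / 2) ^+ 2.
  have -> : 6 * mu * (Rmu / 2) ^+ 2 = 3 / 2 * x by rewrite /x; field.
  lra.
have g_rho : `|g| / (delta - 2 * mu * Rmu ^+ 2) <= rho / 2.
  have rk0 : 0 <= rho / 2 * (delta - 2 * mu * Rmu ^+ 2).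
    by rewrite mulr_ge0 ?divr_ge0// ltW.
  rewrite ler_pdivrMr// -(@ler_pXn2r _ 2)// ?nnegrE//.
  have e0 : 0 < delta * (delta - 4 * x) by rewrite mulr_gt0// subr_gt0.
  (* The definition of [rho] solved for the forcing; [delta * (delta - 4 * x)] falls short of
     [(delta - 2 * x) ^+ 2] by exactly [(2 * x) ^+ 2]. *)
  have -> : `|g| ^+ 2 = (rho / 2) ^+ 2 * (delta * (delta - 4 * x)).
    rewrite expr_div_n rhoE /x; field.
    by rewrite !gt_eqF//; rewrite /x in x4; lra.
  rewrite [leRHS]exprMn kE ler_wpM2l ?sqr_ge0//.
  rewrite -subr_ge0 (_ : _ - _ = (2 * x) ^+ 2) ?sqr_ge0//; ring.
have g_small : `|g| / (delta - 2 * mu * Rmu ^+ 2) < Rmu / 2 by lra.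
have mu_ge0 := ltW mu0.
have [p Up Sp] := dfAL_equilibrium mu_ge0 S_dfAL Rmu0 k0 g_small c0.
have Ap := equilibrium_attractor mu_ge0 S_dfAL Rmu0 k0 g_small c0 Up Sp.
exists [set p]; split; first split => // A rA.
  by rewrite (restricted_attractor_unique mu_ge0 S_dfAL Rmu0 k0 g_small c0 Up Sp rA).
move=> _ ->; rewrite -ball_normE /= sub0r normrN.
(* The a priori bound on attractors puts [p] within [rho / 2] of the origin, and
   [rho / 2 <= rho < r]. *)
have := restricted_attractor_small mu_ge0 S_dfAL Rmu0 k0 Ap erefl.
by move=> /le_lt_trans; apply; lra.
Qed.
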